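(* The class of UF spaces is closed under taking $G_\delta$ subspaces: for every poset $P$ and every $G_\delta$ subset $G$ of $\mathrm{UF}(P)$ (i.e. every countable intersection of open sets), there is a poset $R$ such that $G$, with the subspace topology, is homeomorphic to $\mathrm{UF}(R)$.
   Context: A poset is a set $P$ with a reflexive, antisymmetric, transitive relation $\preceq$; $p\prec q$ means $p\preceq q$ and $p\neq q$. A filter on $P$ is a nonempty subset $F\subseteq P$ such that (1) for all $p,q\in F$ there is $r\in F$ with $r\preceq p$ and $r\preceq q$, and (2) if $p\in F$, $q\in P$ and $p\preceq q$ then $q\in F$. A filter $F$ is unbounded if there is no $r\in P$ with $r\prec q$ for every $q\in F$. $\mathrm{UF}(P)$ is the set of unbounded filters on $P$, with the topology having basis $\{N_p : p\in P\}$, where $N_p=\{F\in \mathrm{UF}(P) : p\in F\}$. A UF space is a space of the form $\mathrm{UF}(P)$ (up to homeomorphism). *)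

(* Defs.v *)
From HB Require Import structures.
From mathcomp Require Import all_boot all_order.
From mathcomp Require Import boolp classical_sets topology borel_hierarchy.

Set Implicit Arguments.
Unset Strict Implicit.
Unset Printing Implicit Defensive.

Import Order.TTheory.

Local Open Scope classical_set_scope.
Local Open Scope order_scope.

Section UF.
Context {d : Order.disp_t} {P : porderType d}.
Implicit Types F : set P.

Definition poset_filter F :=
  [/\ F !=set0,
      forall p q, F p -> F q -> exists r, [/\ F r, r <= p & r <= q] &
      forall p q, F p -> p <= q -> F q].

Definition unbounded F := ~ exists r : P, forall q, F q -> r < q.

End UF.

Record UF (d : Order.disp_t) (P : porderType d) := MkUF {
  UF_set :> set P;
  UF_filter : poset_filter UF_set;
  UF_unbounded : unbounded UF_set }.

Section UF_topology.
Context {d : Order.disp_t} {P : porderType d}.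

HB.instance Definition _ := gen_eqMixin (UF P).
HB.instance Definition _ := gen_choiceMixin (UF P).

Definition UF_basic (p : P) : set (UF P) := [set F | UF_set F p].

Lemma UF_basic_cover : \bigcup_(B in range UF_basic) B = [set: UF P].
Proof.
apply/seteqP; split=> // F _.
by case: (UF_filter F) => -[p Fp] _ _; exists (UF_basic p) => //; exists p.
Qed.

Lemma UF_basic_join (A B : set (UF P)) (F : UF P) :
  range UF_basic A -> range UF_basic B -> A F -> B F ->
  exists C, [/\ range UF_basic C, C F & C `<=` A `&` B].
Proof.
move=> [p _ <-] [q _ <-] Fp Fq.
have [_ dirF _] := UF_filter F; have [r [Fr rp rq]] := dirF _ _ Fp Fq.
exists (UF_basic r); split=> // H Hr.
by have [_ _ upH] := UF_filter H; split; apply: upH Hr _.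
Qed.

(* The base is indexed by itself rather than by P because isBaseTopological
   wants a pointed index type, and P may be empty. *)
HB.instance Definition _ :=
  isBaseTopological.Build (UF P) UF_basic_cover UF_basic_join.

End UF_topology.

Definition homeomorphic (X Y : topologicalType) :=
  exists (f : X -> Y) (g : Y -> X),
    [/\ cancel f g, cancel g f, continuous f & continuous g].

(* Main.v *)
From HB Require Import structures.
Require Import Defs.
From mathcomp Require Import all_boot all_order.
From mathcomp Require Import boolp classical_sets topology borel_hierarchy.

(** Write G as the intersection of open sets U_i and let the depth of p be the
    largest n <= oo such that N_p is contained in U_i for all i < n.  Let R be
    the set of p such that N_p meets G, where q lies below p <> q when q <= p
    and q has larger depth than p (or both have depth oo).  A point of G, which
    is a filter on P all of whose elements are in R, is also an unbounded filter
    on R; conversely an unbounded filter on R generates a point of G.  The depths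
    along an unbounded filter H of R tend to oo because an element p of maximal
    finite depth in H would be its minimum, while any point of G in N_p provides
    elements strictly below p in R.  The filter generated by H on P is unbounded
    because a strict lower bound r would satisfy N_r \subset G, hence have depth
    oo and be a strict lower bound of H in R. *)

Set Implicit Arguments.
Unset Strict Implicit.
Unset Printing Implicit Defensive.

Import Order.TTheory.

Local Open Scope classical_set_scope.
Local Open Scope order_scope.

(** * Points of UF spaces and their basic neighbourhoods *)

Section UF_theory.
Context {d : Order.disp_t} {P : porderType d}.
Implicit Types (p q : P) (F : UF P).

Lemma UF_eq F1 F2 : UF_set F1 = UF_set F2 -> F1 = F2.
Proof.
case: F1 F2 => [S1 f1 u1] [S2 f2 u2] /= E; subst S2.
by congr MkUF; exact: Prop_irrelevance.
Qed.

Lemma UF_up F p q : UF_set F p -> p <= q -> UF_set F q.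
Proof. by case: (UF_filter F) => _ _; apply. Qed.

Lemma UF_dir F p q : UF_set F p -> UF_set F q ->
  exists r, [/\ UF_set F r, r <= p & r <= q].
Proof. by case: (UF_filter F) => _ + _; apply. Qed.

Lemma UF_basic_le p q : p <= q -> UF_basic p `<=` UF_basic q.
Proof. by move=> pq F Fp; exact: UF_up pq. Qed.

Lemma open_UF_basic p : open (UF_basic p).
Proof.
by exists [set UF_basic p]; [move=> _ ->; exists p | rewrite bigcup_set1].
Qed.

Lemma open_UFP (A : set (UF P)) F : open A -> A F ->
  exists2 p, UF_set F p & UF_basic p `<=` A.
Proof.
move=> [D sD <-] [B DB BF]; have [p _ pB] := sD _ DB.
by exists p; [move: BF; rewrite -pB | rewrite pB => x Bx; exists B].
Qed.

(** By Zorn there is a maximal filter containing [p]; a strict lower bound [r] of it would make the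
    principal filter of [r] strictly larger. *)
Lemma UF_basic_nonempty p : UF_basic p !=set0.
Proof.
pose good (A : set P) := A = set0 \/ poset_filter A /\ A p.
have [|A [gA maxA]] := @Zorn_bigcup P good.
  move=> C sC totC; have [[X CX Xp]|noC] := pselect (exists2 X, C X & X p).
    right; split; last by exists X.
    split; first by exists p; exists X.
    - move=> a b [Y CY Ya] [Z CZ Zb].
      have [W [CW Wa Wb]] : exists W, [/\ C W, W a & W b].
        by case: (totC _ _ CY CZ) => s; [exists Z|exists Y]; split=> //; exact: s.
      case: (sC _ CW) Wa Wb => [->//|[[_ dirW _] _] Wa Wb].
      by have [r [Wr ra rb]] := dirW _ _ Wa Wb; exists r; split=> //; exists W.
    - move=> a b [Y CY Ya] ab; exists Y => //.
      by case: (sC _ CY) Ya => [->//|[[_ _ upY] _] Ya]; exact: upY ab.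
  left; rewrite -subset0 => a [Y CY Ya].
  case: (sC _ CY) => [Y0|[_ Yp]]; first by rewrite Y0 in Ya.
  by apply: noC; exists Y.
have up_filter r : poset_filter [set x | r <= x].
  split; first by exists r => /=.
  - by move=> a b /= ra rb; exists r; split=> /=.
  - by move=> a b /= ra; exact: le_trans.
have [fA Ap] : poset_filter A /\ A p.
  case: gA => // A0; exfalso; apply: (maxA [set x | p <= x]).
    by rewrite A0; split=> // /(_ p); apply=> /=.
  by right; split=> //=.
have uA : unbounded A.
  move=> [r rA]; apply: (maxA [set x | r <= x]).
    split=> [x /rA/ltW//|/(_ r) /= /(_ (lexx _))/rA]; by rewrite ltxx.
  by right; split=> //=; exact/ltW/rA.
by exists (MkUF fA uA).
Qed.

End UF_theory.

(** * Depth and the refinement order *)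

Section Gdelta_poset.
Context {d : Order.disp_t} {P : porderType d} (U : nat -> set (UF P)).

Let G : set (UF P) := \bigcap_i U i.

Definition deep (n : nat) (p : P) :=
  forall i, (i < n)%N -> UF_basic p `<=` U i.

Lemma deep_le n p q : q <= p -> deep n p -> deep n q.
Proof.
by move=> qp dp i ltin; exact: subset_trans (UF_basic_le qp) (dp i ltin).
Qed.

Lemma deep_leq m n p : (m <= n)%N -> deep n p -> deep m p.
Proof. by move=> mn dp i im; apply: dp; exact: leq_trans im mn. Qed.

Lemma deep_infty p : (forall n, deep n p) -> UF_basic p `<=` G.
Proof. by move=> dp F Fp i _; exact: (dp i.+1 i). Qed.

(** As [deep n p] is monotone in [n], the implication compares depths without naming them and covers
    depth oo; the first disjunct gives reflexivity at finite depth. *)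
Definition refines (q p : P) :=
  q = p \/ q <= p /\ forall n, deep n p -> deep n.+1 q.

Lemma refines_le p q : refines q p -> q <= p.
Proof. by case=> [->|[]]. Qed.

Lemma refines_refl p : refines p p. Proof. by left. Qed.

Lemma refines_trans p q r : refines r q -> refines q p -> refines r p.
Proof.
case=> [->//|[rq dq]] [<-|[qp dp]]; first by right.
right; split; first exact: le_trans qp.
by move=> n /dp; exact: deep_le.
Qed.

Lemma refines_infty p q : q <= p -> (forall n, deep n q) -> refines q p.
Proof. by move=> qp dq; right. Qed.

Lemma refines_deep n p q : q <= p -> ~ deep n p -> deep n q -> refines q p.
Proof.
move=> qp ndp dq; right; split=> // k dk; apply: deep_leq dq.
by rewrite ltnNge; apply: contra_notN ndp => nk; exact: deep_leq dk.
Qed.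

Definition Gdelta_poset := {p : P | `[< UF_basic p `&` G !=set0 >]}.

HB.instance Definition _ := Choice.on Gdelta_poset.

Definition Gdelta_le (q p : Gdelta_poset) := `[< refines (val q) (val p) >].

Lemma Gdelta_le_refl : reflexive Gdelta_le.
Proof. by move=> p; exact/asboolP/refines_refl. Qed.

Lemma Gdelta_le_anti : antisymmetric Gdelta_le.
Proof.
move=> p q /andP[/asboolP/refines_le pq /asboolP/refines_le qp].
by apply/val_inj/le_anti; rewrite pq qp.
Qed.

Lemma Gdelta_le_trans : transitive Gdelta_le.
Proof.
move=> q p r /asboolP pq /asboolP qr; exact/asboolP/(refines_trans pq).
Qed.

HB.instance Definition _ := Order.Le_isPOrder.Build d Gdelta_poset
  Gdelta_le_refl Gdelta_le_anti Gdelta_le_trans.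

Implicit Types (x y z : Gdelta_poset) (F : UF P) (H : UF Gdelta_poset).

Lemma Gdelta_leP x y : (x <= y) <-> refines (val x) (val y).
Proof. by split=> /asboolP. Qed.

Lemma Gdelta_ltP x y :
  (x < y) <-> val x != val y /\ refines (val x) (val y).
Proof.
rewrite lt_neqAle (inj_eq val_inj).
by split=> [/andP[? /Gdelta_leP]|[-> /Gdelta_leP ->]].
Qed.

Lemma Gdelta_poset_ex F p : G F -> UF_set F p ->
  exists x : Gdelta_poset, val x = p.
Proof.
by move=> GF Fp; unshelve eexists (exist _ p _) => //; apply/asboolP; exists F.
Qed.

Hypothesis openU : forall i, open (U i).

Lemma deep_ex F n : G F -> exists2 p, UF_set F p & deep n p.
Proof.
move=> GF; elim: n => [|n [p Fp dp]].
  by have [[p Fp] _ _] := UF_filter F; exists p.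
have [q Fq qU] := open_UFP (openU n) (GF n I).
have [r [Fr rp rq]] := UF_dir Fp Fq.
exists r => // i; rewrite ltnS leq_eqVlt => /orP[/eqP ->|].
  exact: subset_trans (UF_basic_le rq) qU.
exact: deep_le dp i.
Qed.

(* Either p has depth oo, or anything below p and deep enough will do. *)
Lemma refines_ex F p : G F -> UF_set F p ->
  exists2 s, UF_set F s & forall r, r <= p -> r <= s -> refines r p.
Proof.
move=> GF Fp; have [dp|/existsNP[n ndp]] := pselect (forall n, deep n p).
  by exists p => // r rp _; apply: refines_infty => // n; exact: deep_le (dp n).
have [s Fs ds] := deep_ex n GF; exists s => // r rp rs.
exact: refines_deep ndp (deep_le rs ds).
Qed.

(** * From points of [G] to unbounded filters on [Gdelta_poset] *)

Definition restr F : set Gdelta_poset := [set x | UF_set F (val x)].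

Lemma restr_filter F : G F -> poset_filter (restr F).
Proof.
move=> GF; split.
- have [[p Fp] _ _] := UF_filter F.
  by have [x xp] := Gdelta_poset_ex GF Fp; exists x; rewrite /restr /= xp.
- move=> x y Fx Fy.
  (* Anything in [P] below [x], [y], [s] and [t] at once refines both [x] and [y]. *)
  have [s Fs sx] := refines_ex GF Fx; have [t Ft ty] := refines_ex GF Fy.
  have [a [Fa ax ay]] := UF_dir Fx Fy; have [b [Fb bs bt]] := UF_dir Fs Ft.
  have [r [Fr ra rb]] := UF_dir Fa Fb.
  have [z zr] := Gdelta_poset_ex GF Fr.
  exists z; split; first by rewrite /restr /= zr.
    apply/Gdelta_leP; rewrite zr; apply: sx; first exact: le_trans ax.
    exact: le_trans bs.
  apply/Gdelta_leP; rewrite zr; apply: ty; first exact: le_trans ay.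
  exact: le_trans bt.
- by move=> x y Fx /Gdelta_leP/refines_le; exact: UF_up.
Qed.

Lemma restr_unbounded F : G F -> unbounded (restr F).
Proof.
move=> GF [x xF]; apply: (UF_unbounded (u := F)); exists (val x) => p Fp.
have [y yp] := Gdelta_poset_ex GF Fp.
have /Gdelta_ltP[] : x < y by apply: xF; rewrite /restr /= yp.
by rewrite yp lt_neqAle => -> /refines_le.
Qed.

Definition to_Gdelta_poset (F : set_type G) : UF Gdelta_poset :=
  MkUF (restr_filter (set_valP F)) (restr_unbounded (set_valP F)).

(** * From unbounded filters on [Gdelta_poset] to points of [G] *)

Lemma UF_deep_ex H n : exists2 x, UF_set H x & deep n (val x).
Proof.
elim: n => [|n [x Hx dx]].
  by have [[x Hx] _ _] := UF_filter H; exists x.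
apply: contrapT => noH.
(* An element of [H] strictly below [x] would be deep to level [n.+1], so directedness makes [x] the
   minimum of [H]. *)
have minx y : UF_set H y -> x <= y.
  move=> Hy; have [z [Hz zx zy]] := UF_dir Hx Hy.
  have [zxE|[_ dz]] := (Gdelta_leP _ _).1 zx; first by rewrite -(val_inj zxE).
  by exfalso; apply: noH; exists z => //; exact: dz.
(* A point of [G] through [x] supplies [r] below [x], deep to level [n.+1]. As [x] is not, [r]
   differs from [x] and bounds [H] strictly. *)
have [F [Fx GF]] := asboolW (valP x).
have [q Fq dq] := deep_ex n.+1 GF.
have [r [Fr rx rq]] := UF_dir Fx Fq.
have ndx : ~ deep n.+1 (val x) by move=> dx'; apply: noH; exists x.
have dr := deep_le rq dq.
have [z zr] := Gdelta_poset_ex GF Fr.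
apply: (UF_unbounded (u := H)); exists z => y Hy.
apply: lt_le_trans (minx _ Hy); apply/Gdelta_ltP; rewrite zr; split.
  by apply: contra_notN ndx => /eqP <-.
exact: refines_deep ndx dr.
Qed.

Definition gen H : set P := [set p | exists2 x, UF_set H x & val x <= p].

Lemma gen_filter H : poset_filter (gen H).
Proof.
split.
- by have [[x Hx] _ _] := UF_filter H; exists (val x); exists x.
- move=> p q [x Hx xp] [y Hy yq]; have [z [Hz zx zy]] := UF_dir Hx Hy.
  exists (val z); split; first by exists z.
    by apply: le_trans xp; exact/refines_le/Gdelta_leP.
  by apply: le_trans yq; exact/refines_le/Gdelta_leP.
- by move=> p q [x Hx xp] pq; exists x => //; exact: le_trans pq.
Qed.

Lemma gen_unbounded H : unbounded (gen H).
Proof.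
move=> [r rH].
have ltr x : UF_set H x -> r < val x by move=> Hx; apply: rH; exists x.
have dr n : deep n r.
  by have [x Hx dx] := UF_deep_ex H n; exact: deep_le (ltW (ltr _ Hx)) dx.
(* Nonemptiness of the basic set of [r] is what puts [r] in [Gdelta_poset]. *)
have [F Fr] := UF_basic_nonempty r.
have [z zr] := Gdelta_poset_ex (deep_infty dr Fr) Fr.
apply: (UF_unbounded (u := H)); exists z => x Hx; have rx := ltr _ Hx.
apply/Gdelta_ltP; rewrite zr; split; first by rewrite lt_eqF.
exact: refines_infty (ltW rx) dr.
Qed.

Definition gen_UF H : UF P := MkUF (gen_filter H) (gen_unbounded (H := H)).

Lemma gen_UF_in H : G (gen_UF H).
Proof.
move=> i _; have [x Hx dx] := UF_deep_ex H i.+1.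
by apply: (dx i) => //; exists x.
Qed.

Definition of_Gdelta_poset H : set_type G := SigSub (mem_set (gen_UF_in H)).

(** * The two maps are mutually inverse and continuous *)

Lemma to_Gdelta_posetK : cancel to_Gdelta_poset of_Gdelta_poset.
Proof.
move=> F; apply/val_inj/UF_eq/seteqP; split=> p /=.
  by move=> [x Fx]; exact: UF_up.
move=> Fp; have [x xp] := Gdelta_poset_ex (set_valP F) Fp.
by exists x; rewrite /= /restr /= xp.
Qed.

Lemma of_Gdelta_posetK : cancel of_Gdelta_poset to_Gdelta_poset.
Proof.
move=> H; apply/UF_eq/seteqP; split=> x /=; last by exists x.
move=> [y Hy yx].
(* The inequality [yx] holds only in [P]. If [x] has finite depth, going below [y] to a deeper
   element of [H] turns it into a refinement. *)
have [z Hz zx] : exists2 z, UF_set H z & refines (val z) (val x).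
  have [dx|/existsNP[n ndx]] := pselect (forall n, deep n (val x)).
    by exists y => //; apply: refines_infty => // n; exact: deep_le (dx n).
  have [w Hw dw] := UF_deep_ex H n; have [z [Hz zy zw]] := UF_dir Hy Hw.
  exists z => //; apply: refines_deep ndx _.
    by apply: le_trans yx; exact/refines_le/Gdelta_leP.
  by apply: deep_le dw; exact/refines_le/Gdelta_leP.
by apply: UF_up Hz _; exact/Gdelta_leP.
Qed.

Lemma to_Gdelta_poset_continuous : continuous to_Gdelta_poset.
Proof.
apply/continuousP => A oA; rewrite openE => F AF.
have [x Fx xA] := open_UFP oA AF.
have : nbhs F ((val : set_type (\bigcap_i U i) -> UF P) @^-1` UF_basic (val x)).
  apply: initial_continuous; apply: open_nbhs_nbhs; split => //.
  exact: open_UF_basic.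
by apply: filterS => F' F'x; exact: xA.
Qed.

(** The filter generated by [H] contains [p] exactly when some [x] in [H] lies below [p], a
    condition that is open in [H]. *)
Lemma of_Gdelta_poset_continuous : continuous of_Gdelta_poset.
Proof.
apply: continuous_comp_initial; apply/continuousP => A oA; rewrite openE => H AH.
have [p [x Hx xp] pA] := open_UFP oA AH.
have : nbhs H (UF_basic x).
  by apply: open_nbhs_nbhs; split => //; exact: open_UF_basic.
by apply: filterS => H' H'x; apply: pA; exists x.
Qed.

End Gdelta_poset.

(* The coercion set_type sends G to the type of its points, which carries the
   subspace topology (the initial topology of the inclusion). *)
Theorem theorem4p7 (d : Order.disp_t) (P : porderType d) (G : set (UF P))
    (hG : Gdelta G) :
  exists (d' : Order.disp_t) (R : porderType d'),
    homeomorphic (set_type G) (UF R).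
Proof.
have [U openU ->] := hG; exists d, (Gdelta_poset U : porderType d).
exists (to_Gdelta_poset openU), (of_Gdelta_poset openU); split.
- exact: to_Gdelta_posetK.
- exact: of_Gdelta_posetK.
- exact: to_Gdelta_poset_continuous.
- exact: of_Gdelta_poset_continuous.
Qed.
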